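(* Let $X$ be a Banach space and assume that $X$ contains a complemented copy of a Banach space $Z$ (a complemented closed subspace isomorphic to $Z$). Then there exists an equivalent norm on $X$ such that $X$ with this norm contains an isometric copy of $Z$. In particular, if $X$ is a Banach function space on $I$, where $I=[0,1]$ or $I=[0,\infty)$, and $T=C$ (the Cesàro operator) or $T=C^*$ (the Copson operator), then: (i) the space $TX$ can be renormed (with an equivalent norm) to contain an isometric copy of $L^1[0,1]$, whenever $TX\neq\{0\}$; (ii) if the Tandori function space $\widetilde X$ is nontrivial (i.e. $\widetilde X\ne\{0\}$), then it can be renormed (with an equivalent norm) to contain an isometric copy of $L^\infty[0,1]$.
   Context: $L^0(I)$ is the space of (a.e. equivalence classes of) real-valued Lebesgue measurable functions on $I$. A Banach function space $X$ on $I$ is a Banach space that is a linear subspace of $L^0(I)$ with the ideal property: $|f|\le|g|$ a.e., $f\in L^0(I)$, $g\in X$ imply $f\in X$ and $\|f\|_X\le\|g\|_X$; by convention $X$ is also assumed to contain a function positive a.e. on $I$ (this is not assumed for the derived spaces $TX$, $\widetilde X$). Cesàro operator: $Cf(x)=\frac1x\int_0^x f(t)\,dt$ for $0<x\in I$. Copson operator: $C^*f(x)=\int_{I\cap[x,\infty)}\frac{f(t)}{t}\,dt$ for $x\in I$. For $T\in\{C,C^*\}$: $TX=\{f\in L^0(I): T|f|\in X\}$ with norm $\|f\|_{TX}=\|T|f|\|_X$. Tandori space: $\widetilde X=\{f\in L^0(I):\widetilde f\in X\}$ with norm $\|f\|_{\widetilde X}=\|\widetilde f\|_X$, where $\widetilde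 f(x)=\operatorname{ess\,sup}_{t\in I,\,t\ge x}|f(t)|$. *)

(* Defs.v *)
From HB Require Import structures.
From mathcomp Require Import all_boot all_order all_algebra.
From mathcomp Require Import all_classical all_reals all_analysis.
From mathcomp Require Import measurable_realfun ess_sup_inf.
Set Implicit Arguments.
Unset Strict Implicit.
Unset Printing Implicit Defensive.
Import Order.TTheory GRing.Theory Num.Theory.
Import numFieldNormedType.Exports.
Local Open Scope classical_set_scope.
Local Open Scope ring_scope.

Section L0_lmodule.
Context d (T : measurableType d) (R : realType).
Variable mu : {measure set T -> \bar R}.
Local Open Scope quotient_scope.

Definition L0 : Type := {mfun_ mu, T >-> R}.
HB.instance Definition _ := Choice.on L0.
HB.instance Definition _ := EqQuotient.on L0.
Definition L0_fun (f : L0) : T -> R := repr f.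
Coercion L0_fun : L0 >-> Funclass.

Lemma L0_piP (f g : {mfun T >-> R}) :
  \pi_L0 f = \pi_L0 g <-> (f = g %[ae mu]).
Proof. by split=> [/eqmodP /asboolP //|fg]; apply/eqmodP/asboolP. Qed.

Lemma L0_reprP (f : {mfun T >-> R}) : repr (\pi_L0 f) = f %[ae mu].
Proof. by apply/L0_piP; rewrite reprK. Qed.

Definition L0_zero : L0 := \pi_L0 0.
Definition L0_opp (f : L0) : L0 := \pi_L0 (- repr f).
Definition L0_add (f g : L0) : L0 := \pi_L0 (repr f + repr g).
Definition L0_scale (a : R) (f : L0) : L0 := \pi_L0 (a *: repr f).

Let piN (f : {mfun T >-> R}) : L0_opp (\pi_L0 f) = \pi_L0 (- f).
Proof.
apply/L0_piP; apply: filterS (L0_reprP f) => x h xT.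
by change (- repr (\pi_L0 f) x = - f x); rewrite h.
Qed.

Let piD (f g : {mfun T >-> R}) : L0_add (\pi_L0 f) (\pi_L0 g) = \pi_L0 (f + g).
Proof.
apply/L0_piP; apply: filterS2 (L0_reprP f) (L0_reprP g) => x hf hg xT.
change (repr (\pi_L0 f) x + repr (\pi_L0 g) x = f x + g x).
by rewrite hf// hg.
Qed.

Let piZ a (f : {mfun T >-> R}) : L0_scale a (\pi_L0 f) = \pi_L0 (a *: f).
Proof.
apply/L0_piP; apply: filterS (L0_reprP f) => x h xT.
by change (a * repr (\pi_L0 f) x = a * f x); rewrite h.
Qed.

Let L0E (f : L0) : f = \pi_L0 (repr f).
Proof. by rewrite reprK. Qed.

Let addA : associative L0_add.
Proof. by move=> f g h; rewrite (L0E f) (L0E g) (L0E h) !piD addrA. Qed.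

Let addC : commutative L0_add.
Proof. by move=> f g; rewrite (L0E f) (L0E g) !piD addrC. Qed.

Let add0 : left_id L0_zero L0_add.
Proof. by move=> f; rewrite (L0E f) /L0_zero piD add0r. Qed.

Let addN : left_inverse L0_zero L0_opp L0_add.
Proof. by move=> f; rewrite (L0E f) piN piD addNr. Qed.

HB.instance Definition _ := GRing.isZmodule.Build L0 addA addC add0 addN.

Let scaleA a b f : L0_scale a (L0_scale b f) = L0_scale (a * b) f.
Proof. by rewrite (L0E f) !piZ scalerA. Qed.

Let scale1 : left_id 1 L0_scale.
Proof. by move=> f; rewrite (L0E f) piZ scale1r. Qed.

Let scaleDr : right_distributive L0_scale +%R.
Proof.
move=> a f g; change (L0_scale a (L0_add f g) =
  L0_add (L0_scale a f) (L0_scale a g)).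
by rewrite (L0E f) (L0E g) piD !piZ piD scalerDr.
Qed.

Let scaleDl f : {morph L0_scale^~ f : a b / a + b}.
Proof.
move=> a b; change (L0_scale (a + b) f =
  L0_add (L0_scale a f) (L0_scale b f)).
by rewrite (L0E f) !piZ piD scalerDl.
Qed.

HB.instance Definition _ :=
  GRing.Zmodule_isLmodule.Build R L0 scaleA scale1 scaleDr scaleDl.

End L0_lmodule.

Section renorming.
Context (R : realType).

(* [D], with the norm [N], is a normed linear space sitting inside the ambient
   vector space [V]; the values of [N] outside [D] are irrelevant. *)
Record normed_subspace (V : lmodType R) (D : set V) (N : V -> R) : Prop := {
  normed_subspace0 : D 0 ;
  normed_subspaceP : forall (a : R) (f g : V), D f -> D g -> D (a *: f + g) ;
  normed_subspace_eq0 : forall f, D f -> N f = 0 -> f = 0 ;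
  normed_subspaceZ : forall (a : R) (f : V), D f -> N (a *: f) = `|a| * N f ;
  normed_subspace_le : forall f g, D f -> D g -> N (f + g) <= N f + N g }.

Definition complete_subspace (V : lmodType R) (D : set V) (N : V -> R) : Prop :=
  forall u : nat -> V, (forall n, D (u n)) ->
    (forall e : R, 0 < e -> exists n0, forall m n,
       (n0 <= m)%N -> (n0 <= n)%N -> N (u m - u n) < e) ->
    exists2 l, D l & (fun n => N (u n - l)) @ \oo --> (0 : R).

Definition equivalent_norms (V : lmodType R) (D : set V) (N N' : V -> R) :
    Prop :=
  exists c C : R, [/\ 0 < c, 0 < C &
    forall f, D f -> c * N f <= N' f /\ N' f <= C * N f].

Definition contains_isometric_copy (V : lmodType R) (D : set V) (N : V -> R)
    (W : lmodType R) (E : set W) (M : W -> R) : Prop :=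
  exists J : W -> V,
    [/\ forall z, E z -> D (J z),
        forall (a : R) z w, E z -> E w -> J (a *: z + w) = a *: J z + J w &
        forall z, E z -> N (J z) = M z].

Definition renormable_to_contain (V : lmodType R) (D : set V) (N : V -> R)
    (W : lmodType R) (E : set W) (M : W -> R) : Prop :=
  exists N' : V -> R,
    [/\ normed_subspace D N', equivalent_norms D N N' &
        contains_isometric_copy D N' E M].

Definition complemented_subspace (X : normedModType R) (Y : set X) : Prop :=
  exists P : {linear X -> X},
    [/\ continuous P, forall x, P (P x) = P x & range P = Y].

Definition isomorphic_to_subspace (Z X : normedModType R) (Y : set X) : Prop :=
  exists (T : {linear Z -> X}) (S : X -> Z),
    [/\ continuous T, range T = Y, cancel T S & {within Y, continuous S}].

Definition contains_complemented_copy (X Z : normedModType R) : Prop :=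
  exists Y : set X,
    [/\ closed Y, complemented_subspace Y & isomorphic_to_subspace Z Y].

End renorming.

Section function_spaces.
Context (R : realType).
Implicit Types (i : interval R) (p : \bar R).

(* Functions on [i] are represented by functions on the whole line, identified
   when they agree almost everywhere on [i]. Borel and Lebesgue measurable
   functions have the same almost-everywhere classes. *)
Definition lebesgue_on i : {measure set (measurableTypeR R) -> \bar R} :=
  mrestr lebesgue_measure (measurable_itv i).

Local Notation L0_on i := (L0 (lebesgue_on i)).

Record banach_function_space i (X : set (L0_on i)) (N : L0_on i -> R) : Prop :=
{ bfs_normed : normed_subspace X N ;
  bfs_complete : complete_subspace X N ;
  bfs_ideal : forall f g : L0_on i,
    (\forall x \ae lebesgue_on i, `|f x| <= `|g x|) -> X g ->
    X f /\ N f <= N g ;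
  bfs_unit : exists2 g, X g & \forall x \ae lebesgue_on i, 0 < g x }.

Definition abs_fun i (f : L0_on i) : R -> \bar R := fun t => `|f t|%:E.

Local Open Scope ereal_scope.

(* Only the values at the points x > 0 of the interval matter. *)
Definition cesaro_op (f : R -> \bar R) : R -> \bar R := fun x =>
  (x^-1)%:E * \int[lebesgue_measure]_(t in `[0%R, x]) f t.

Definition copson_op i (f : R -> \bar R) : R -> \bar R := fun x =>
  \int[lebesgue_measure]_(t in [set` i] `&` `[x, +oo[) (f t * (t^-1)%:E).

Definition tandori_majorant i (f : R -> \bar R) : R -> \bar R := fun x =>
  ess_sup (mrestr (lebesgue_on i) (measurable_itv `[x, +oo[)) f.

(* For an operator [T] with extended real values, the space of those [f] such
   that [T |f|] belongs to [X], with the norm of [T |f|] in [X]. In particular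
   [T |f|] has to be finite almost everywhere. *)
Definition derived_space i (T : (R -> \bar R) -> R -> \bar R)
    (X : set (L0_on i)) : set (L0_on i) :=
  [set f | exists2 g, X g &
    \forall x \ae lebesgue_on i, (g x)%:E = T (abs_fun f) x].

Definition derived_norm i (T : (R -> \bar R) -> R -> \bar R)
    (N : L0_on i -> R) (f : L0_on i) : R :=
  N (xget (0%R : L0_on i) [set g : L0_on i |
    \forall x \ae lebesgue_on i, (g x)%:E = T (abs_fun f) x]).

Definition Lp_space i p : set (L0_on i) :=
  [set f | finite_norm (lebesgue_on i) p f].

Definition Lp_norm i p (f : L0_on i) : R :=
  fine 'N[lebesgue_on i]_p[EFin \o f].

End function_spaces.
Arguments Lp_space {R} i p.
Arguments Lp_norm {R} i p f.
Arguments cesaro_op {R}.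
Notation L0_on i := (L0 (lebesgue_on i)).

(* Main.v *)
From HB Require Import structures.
Require Import Defs.
From mathcomp Require Import all_boot all_order all_algebra.
From mathcomp Require Import all_classical all_reals all_analysis.
From mathcomp Require Import measurable_realfun ess_sup_inf ring.
Import Order.TTheory GRing.Theory Num.Theory.
Import numFieldNormedType.Exports.
Local Open Scope classical_set_scope.
Local Open Scope ring_scope.
Set Implicit Arguments.
Unset Strict Implicit.
Unset Printing Implicit Defensive.

(** The equivalent norm is explicit. A complemented copy of Z in X amounts to
    bounded linear maps J : Z -> X and Q : X -> Z with Q J = id: take for J the
    embedding and for Q the projection followed by the inverse of J. Then
<<
      N' f = |Q f|_Z + |f - J (Q f)|_X
>>
    is a norm on X. It is equivalent to the given one by the triangle inequality
    and the boundedness of J and Q, and N' (J z) = |z|_Z, because the second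
    term vanishes on the range of J. This is [renormable_of_retract]; it is
    stated for normed subspaces, so as to cover the spaces of classes of
    functions of (i) and (ii) as well as abstract Banach spaces.

    In the function spaces, the complemented copy consists of the functions that
    live on a well-chosen interval [a, b] inside I, with 0 < a < b. The map J
    transports a function on [0, 1] to [a, b] by an affine change of variable
    and extends it by zero; Q restricts to [a, b] and transports back. Both are
    bounded as soon as T is bracketed by two functions u and v of X, u nonzero:
<<
      |Q f|_p u <= T |f|     and     T |J h| <= |h|_p v     a.e.
>>
    ([renormable_of_bracket]). Write 1_E for the indicator of E. For the Cesaro
    operator, u and v are constant multiples of (1/x) 1_[b,oo) and
    (1/x) 1_[a,oo), since the integral over [0, x] sees all of [a, b] when
    x >= b and nothing of it when x < a. For the Copson operator they are
    multiples of 1_[0,a] and 1_[0,b], the weight 1/t being bounded from above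
    and below on [a, b]. For the Tandori majorant they are these two indicators,
    with p = oo.

    That v belongs to X is where nontriviality enters. If F is a nonzero element
    of the derived space, T |F| is positive at some interior point x0. Since the
    integrals and essential suprema that define T are monotone in x, T |F|
    dominates a positive multiple of v when a = x0 (Cesaro) or b = x0 (Copson,
    Tandori); the ideal property of X then yields v, and after it u.

    Finally the derived spaces have to be normed spaces. This only uses that
    f |-> T |f| is measurable, subadditive, homogeneous and definite
    ([sublinear_on], [normed_subspace_derived]). *)

(** * Renorming along a bounded retraction *)

Section normed_subspace_theory.
Context (R : realType) (V : lmodType R) (D : set V) (N : V -> R).
Hypothesis DN : normed_subspace D N.

Lemma normed_subspaceD f g : D f -> D g -> D (f + g).
Proof. by move=> Df Dg; rewrite -[f]scale1r; exact: (normed_subspaceP DN). Qed.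

Lemma normed_subspaceB f g : D f -> D g -> D (f - g).
Proof.
by move=> Df Dg; rewrite addrC -scaleN1r; exact: (normed_subspaceP DN).
Qed.

Lemma normed_subspace_scale a f : D f -> D (a *: f).
Proof.
by move=> Df; rewrite -[_ *: _]addr0; apply: (normed_subspaceP DN) => //;
  exact: (normed_subspace0 DN).
Qed.

Lemma normed_subspace_norm0 : N 0 = 0.
Proof.
by rewrite -(scale0r 0) (normed_subspaceZ DN) ?normr0 ?mul0r//;
  exact: (normed_subspace0 DN).
Qed.

Lemma normed_subspace_normN f : D f -> N (- f) = N f.
Proof.
by move=> Df; rewrite -scaleN1r (normed_subspaceZ DN)// normrN1 mul1r.
Qed.

Lemma normed_subspace_ge0 f : D f -> 0 <= N f.
Proof.
move=> Df; have DNf : D (- f).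
  by rewrite -scaleN1r; exact: normed_subspace_scale.
have := normed_subspace_le DN Df DNf.
rewrite subrr normed_subspace_norm0 normed_subspace_normN// -mulr2n.
by rewrite pmulrn_lge0.
Qed.

Lemma normed_subspace_gt0 f : D f -> f <> 0 -> 0 < N f.
Proof.
move=> Df f0; rewrite lt_neqAle normed_subspace_ge0// andbT eq_sym.
by apply/eqP => /(normed_subspace_eq0 DN Df).
Qed.

End normed_subspace_theory.

(** The new norm is M (Q f) + N (f - J (Q f)). It is definite although each
    summand may vanish by itself: M (Q f) = 0 forces J (Q f) = 0, and then the
    second summand is N f. *)
Lemma renormable_of_retract (R : realType) (V W : lmodType R)
    (D : set V) (N : V -> R) (E : set W) (M : W -> R)
    (J : W -> V) (Q : V -> W) (cJ cQ : R) :
  normed_subspace D N -> normed_subspace E M -> 0 <= cJ -> 0 <= cQ ->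
  (forall z, E z -> D (J z)) ->
  (forall a z w, E z -> E w -> J (a *: z + w) = a *: J z + J w) ->
  (forall f, D f -> E (Q f)) ->
  (forall a f g, D f -> D g -> Q (a *: f + g) = a *: Q f + Q g) ->
  (forall z, E z -> Q (J z) = z) ->
  (forall z, E z -> N (J z) <= cJ * M z) ->
  (forall f, D f -> M (Q f) <= cQ * N f) ->
  renormable_to_contain D N E M.
Proof.
move=> DN EM cJ0 cQ0 DJ Jlin EQ Qlin QJ NJ MQ.
pose P f := J (Q f).
have DP f : D f -> D (P f) by move=> Df; exact/DJ/EQ.
have DfP f : D f -> D (f - P f).
  by move=> Df; apply: (normed_subspaceB DN) => //; exact: DP.
have J0 : J 0 = 0.
  have E0 := normed_subspace0 EM.
  by have /eqP := Jlin 1 0 0 E0 E0; rewrite !scale1r addr0 addrC -subr_eq subrr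
    => /eqP.
have Q0 : Q 0 = 0.
  have D0 := normed_subspace0 DN.
  by have /eqP := Qlin 1 0 0 D0 D0; rewrite !scale1r addr0 addrC -subr_eq subrr
    => /eqP.
have Plin a f g : D f -> D g ->
    a *: f + g - P (a *: f + g) = a *: (f - P f) + (g - P g).
  move=> Df Dg; rewrite /P Qlin// Jlin; [|exact: EQ|exact: EQ].
  by rewrite opprD addrACA scalerBr.
have PZ a f : D f -> a *: f - P (a *: f) = a *: (f - P f).
  move=> Df; have := Plin a f 0 Df (normed_subspace0 DN).
  by rewrite /P Q0 J0 subr0 !addr0.
have QZ a f : D f -> Q (a *: f) = a *: Q f.
  move=> Df; have := Qlin a f 0 Df (normed_subspace0 DN).
  by rewrite Q0 !addr0.
pose N' f := M (Q f) + N (f - P f).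
have M0 f : D f -> 0 <= M (Q f).
  by move=> Df; apply: (normed_subspace_ge0 EM); exact: EQ.
have N0 f : D f -> 0 <= N (f - P f).
  by move=> Df; apply: (normed_subspace_ge0 DN); exact: DfP.
exists N'; split.
- split.
  + exact: (normed_subspace0 DN).
  + exact: (normed_subspaceP DN).
  + move=> f Df /eqP; rewrite /N' paddr_eq0 ?M0 ?N0// => /andP[/eqP Mf /eqP Nf].
    have Qf := normed_subspace_eq0 EM (EQ _ Df) Mf.
    by apply: (normed_subspace_eq0 DN Df); rewrite -[RHS]Nf /P Qf J0 subr0.
  + move=> a f Df; rewrite /N' QZ// PZ// (normed_subspaceZ EM); last exact: EQ.
    by rewrite (normed_subspaceZ DN) ?mulrDr//; exact: DfP.
  + move=> f g Df Dg; rewrite /N'.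
    have := Qlin 1 f g Df Dg; have := Plin 1 f g Df Dg.
    rewrite !scale1r => -> ->; rewrite [leRHS]addrACA lerD//.
      by apply: (normed_subspace_le EM); exact: EQ.
    by apply: (normed_subspace_le DN); exact: DfP.
- exists (cJ + 1)^-1, (cQ + (1 + cJ * cQ)); split.
  + by rewrite invr_gt0 ltr_wpDl.
  + by rewrite ltr_wpDl// ltr_pwDl// mulr_ge0.
  move=> f Df; have NP : N (P f) <= cJ * M (Q f) by apply: NJ; exact: EQ.
  split.
    rewrite ler_pdivrMl ?ltr_wpDl//.
    have := normed_subspace_le DN (DP _ Df) (DfP _ Df).
    rewrite addrC subrK /N' => /le_trans; apply.
    rewrite mulrDr lerD//.
      by rewrite (le_trans NP)// ler_wpM2r ?M0// lerDl.
    by rewrite ler_peMl ?N0// lerDr.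
  rewrite /N' mulrDl lerD//; first exact: MQ.
  have := normed_subspace_le DN Df
    (normed_subspace_scale DN (-1) (DP _ Df)).
  rewrite scaleN1r (normed_subspace_normN DN); last exact: DP.
  move=> /le_trans; apply; rewrite mulrDl mul1r lerD2l (le_trans NP)//.
  by rewrite -mulrA ler_wpM2l// MQ.
- exists J; split => // z Ez.
  by rewrite /N' /P QJ// subrr (normed_subspace_norm0 DN) addr0.
Qed.

Lemma normed_subspace_setT (R : realType) (V : normedModType R) :
  normed_subspace [set: V] (fun x : V => `|x|).
Proof.
split=> //.
- by move=> f _ /eqP; rewrite normr_eq0 => /eqP.
- by move=> a f _; rewrite normrZ.
- by move=> f g _ _; exact: ler_normD.
Qed.

Lemma bounded_of_continuous (R : realType) (V W : normedModType R)
    (f : V -> W) : linear f -> {for 0, continuous f} ->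
  exists2 c, 0 <= c & forall x, `|f x| <= c * `|x|.
Proof.
move=> flin f0.
pose f_mixin := GRing.isLinear.Build R V W _ f flin.
pose F : {linear V -> W} := HB.pack f f_mixin.
have /linear_boundedP[r [rreal Fr]] := @continuous_linear_bounded _ _ _ 0 F f0.
exists (Num.max r 0 + 1).
  by rewrite addr_ge0// le_max lexx orbT.
by apply: Fr; rewrite ltr_pwDr// le_max lexx.
Qed.

(** The inverse S of the embedding is given on the range Y of the projection P
    only, so the retraction is S \o P; it is linear because S inverts a linear
    map on Y, and continuous at 0 because S is continuous within Y. *)
Lemma renormable_of_complemented_copy (R : realType)
    (X Z : completeNormedModType R) : contains_complemented_copy X Z ->
  renormable_to_contain [set: X] (fun x : X => `|x|)
                        [set: Z] (fun z : Z => `|z|).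
Proof.
move=> [Y [_ [P [Pcont PP rangeP]] [T [S [Tcont rangeT TS Scont]]]]].
have YP x : Y (P x) by rewrite -rangeP; exists x.
have TSY y : Y y -> T (S y) = y by rewrite -rangeT => -[z _ <-]; rewrite TS.
have PT z : P (T z) = T z.
  have : Y (T z) by rewrite -rangeT; exists z.
  by rewrite -rangeP => -[x _ <-].
have SPlin : linear (S \o P).
  move=> a x y /=; apply: (can_inj TS).
  by rewrite TSY// !linearP/= !TSY.
have SPcont : {for 0, continuous (S \o P)}.
  move/subspace_continuousP : Scont => /(_ (P 0) (YP 0)) Scont.
  move=> B SB; rewrite nbhs_simpl.
  apply: (@filterS _ (nbhs (0 : X)) _ _ _ _ (Pcont 0 _ (Scont B SB))).
  by move=> x /= /(_ (YP x)).
have [cT cT0 Tbnd] := bounded_of_continuous (linearP T) (Tcont 0).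
have [cQ cQ0 Qbnd] := bounded_of_continuous SPlin SPcont.
apply: (renormable_of_retract (J := T) (Q := S \o P)
  (cJ := cT) (cQ := cQ)) => //.
- exact: normed_subspace_setT.
- exact: normed_subspace_setT.
- by move=> a z w _ _; rewrite linearP.
- by move=> a f g _ _; exact: SPlin.
- by move=> z _ /=; rewrite PT TS.
Qed.

(** * Classes of measurable functions, restrictions and affine maps *)

Section L0_theory.
Context d (T : measurableType d) (R : realType).
Variable mu : {measure set T -> \bar R}.

Lemma L0P (f g : L0 mu) : (\forall x \ae mu, f x = g x) -> f = g.
Proof.
move=> fg; rewrite -[f]reprK -[g]reprK.
by apply/L0_piP; apply: filterS fg => x + _.
Qed.

Lemma measurable_L0 (f : L0 mu) : measurable_fun setT f.
Proof. exact: measurable_funP. Qed.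

Definition mfun_of (f : T -> R) (mf : measurable_fun setT f) : {mfun T >-> R} :=
  HB.pack f (isMeasurableFun.Build _ _ _ _ f mf).

Definition toL0 (f : T -> R) (mf : measurable_fun setT f) : L0 mu :=
  (\pi_(L0 mu) (mfun_of mf))%qT.

Lemma toL0E (f : T -> R) (mf : measurable_fun setT f) :
  \forall x \ae mu, toL0 mf x = f x.
Proof. by apply: filterS (L0_reprP mu (mfun_of mf)) => x /(_ I). Qed.

Lemma L0_0E : \forall x \ae mu, (0 : L0 mu) x = 0.
Proof. by apply: filterS (L0_reprP mu 0) => x /(_ I). Qed.

Lemma L0_DE (f g : L0 mu) : \forall x \ae mu, (f + g : L0 mu) x = f x + g x.
Proof. by apply: filterS (L0_reprP mu (repr f + repr g)) => x /(_ I). Qed.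

Lemma L0_ZE a (f : L0 mu) : \forall x \ae mu, (a *: f : L0 mu) x = a * f x.
Proof. by apply: filterS (L0_reprP mu (a *: repr f)) => x /(_ I). Qed.

Lemma L0_PE a (f g : L0 mu) :
  \forall x \ae mu, (a *: f + g : L0 mu) x = a * f x + g x.
Proof. by apply: filterS2 (L0_DE (a *: f) g) (L0_ZE a f) => x -> ->. Qed.

End L0_theory.

Section restriction.
Context d (T : measurableType d) (R : realType).
Variable mu : {measure set T -> \bar R}.
Variables (D : set T) (mD : measurable D).

Lemma ae_mrestr (P : T -> Prop) :
  (\forall x \ae mrestr mu mD, P x) <-> (\forall x \ae mu, D x -> P x).
Proof.
split=> -[A [mA A0 PA]].
  exists (A `&` D); split => //; first exact: measurableI.
  by move=> x /not_implyP[Dx nPx]; split => //; exact: PA.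
exists (A `|` ~` D); split.
- by apply: measurableU => //; exact: measurableC.
- rewrite /mrestr setIUl setICl setU0.
  by apply: (subset_measure0 (measurableI _ _ mA mD) mA) A0; exact: subIsetl.
- move=> x /= nPx; have [Dx|?] := pselect (D x); last by right.
  by left; apply: PA => /(_ Dx).
Qed.

Lemma integral_mrestr (f : T -> \bar R) : measurable_fun setT f ->
  (forall x, 0 <= f x)%E ->
  (\int[mrestr mu mD]_x f x = \int[mu]_(x in D) f x)%E.
Proof.
move=> mf f0.
rewrite (@ge0_negligible_integral _ _ _ _ setT (~` D))//.
- rewrite setTD setCK; apply: eq_measure_integral => A mA AD.
  by rewrite /= /mrestr (setIidl AD).
- exact: measurableC.
- by rewrite /= /mrestr setICl.
Qed.

End restriction.

Section affine.
Context (R : realType).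
Local Notation mu := (@lebesgue_measure R).

Lemma measurable_affine (k c : R) :
  measurable_fun setT
    (fun x : measurableTypeR R => (k * x + c : measurableTypeR R)%R).
Proof. by apply: measurable_funD => //; exact: mulrl_measurable. Qed.

(** Lebesgue measure is determined by its values on half-open intervals, and k
    times its image under x |-> k x + c has the right ones. *)
Lemma lebesgue_measure_affine (k c : R) (B : set (measurableTypeR R)) : 0 < k ->
  measurable B ->
  (mu ((fun x => (k * x + c : measurableTypeR R)%R) @^-1` B) =
   k^-1%:E * mu B)%E.
Proof.
move=> k0 mB.
pose phi (x : measurableTypeR R) : measurableTypeR R := (k * x + c)%R.
have mphi : measurable_fun setT phi by exact: measurable_affine.
pose k' : {nonneg R} := NngNum (ltW k0).
have -> : mu B = (k%:E * mu (phi @^-1` B))%E.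
  have/(_ mphi) := @lebesgue_measure_unique R (mscale k' (pushforward mu phi)).
  apply => //= _ [[a b]] _ <-.
  transitivity (k%:E * mu (phi @^-1` `]a, b]%classic))%E; last by [].
  have -> : phi @^-1` `]a, b]%classic =
      `](a - c) / k, (b - c) / k]%classic.
    apply/seteqP; split=> x; rewrite /phi /= !in_itv/=.
      by rewrite ltr_pdivrMr// ler_pdivlMr// ltrBlDr lerBrDr mulrC.
    by rewrite ltr_pdivrMr// ler_pdivlMr// ltrBlDr lerBrDr mulrC.
  rewrite !lebesgue_measure_itv/= !lte_fin ltr_pM2r ?invr_gt0// ltrD2r.
  case: ifPn => _; last by rewrite mule0.
  by rewrite -!EFinB -EFinM; congr EFin; field; rewrite gt_eqF.
by rewrite muleA -EFinM mulVf ?gt_eqF// mul1e.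
Qed.

Lemma ae_affine (k c : R) (P : R -> Prop) : 0 < k ->
  {ae mu, forall x : measurableTypeR R, P x} ->
  {ae mu, forall x : measurableTypeR R, P (k * x + c)%R}.
Proof.
move=> k0 [A [mA A0 PA]].
exists ((fun x => (k * x + c : measurableTypeR R)) @^-1` A); split.
- by rewrite -[X in measurable X]setTI; exact: measurable_affine.
- by rewrite lebesgue_measure_affine// A0 mule0.
- by move=> x /= nP; exact: PA.
Qed.

Lemma integral_affine (k c : R) (D : set (measurableTypeR R))
    (f : measurableTypeR R -> \bar R) : 0 < k ->
  measurable D -> measurable_fun setT f -> (forall x, 0 <= f x)%E ->
  (\int[mu]_(x in (fun x => (k * x + c)%R) @^-1` D) f (k * x + c)%R =
   k^-1%:E * \int[mu]_(x in D) f x)%E.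
Proof.
move=> k0 mD mf f0.
have mphi := measurable_affine k c.
have kV0 : 0 <= k^-1 by rewrite invr_ge0 ltW.
have := @ge0_integral_pushforward _ _ _ _ R _ mphi mu D f mD.
rewrite /comp => <-//; [|exact: measurable_funTS].
rewrite -[(k^-1)]/((NngNum kV0)%:num) -ge0_integral_mscale//; last first.
  exact: measurable_funTS.
apply: eq_measure_integral => A mA AD.
exact: lebesgue_measure_affine.
Qed.

End affine.

(** * The normed spaces L^p *)

Lemma eq_ae_Lnorm d (T : measurableType d) (R : realType)
    (mu : {measure set T -> \bar R}) (p : \bar R) (f g : T -> R) :
  measurable_fun setT f -> measurable_fun setT g ->
  (\forall x \ae mu, f x = g x) ->
  ('N[mu]_p[EFin \o f] = 'N[mu]_p[EFin \o g])%E.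
Proof.
move=> mf mg fg; rewrite unlock /Lnorm; case: p => [r| |].
- congr (_ `^ _)%E; apply: ge0_ae_eq_integral => //=.
  + apply/measurable_EFinP.
    by apply: (@measurableT_comp _ _ _ _ _ _ (@powR R ^~ r)) => //;
      exact: measurableT_comp.
  + apply/measurable_EFinP.
    by apply: (@measurableT_comp _ _ _ _ _ _ (@powR R ^~ r)) => //;
      exact: measurableT_comp.
  + by apply: filterS fg => x + _ => /= ->.
- congr (if _ then _ else _); apply: eq_ess_sup.
  by apply: filterS fg => x /= ->.
- congr (if _ then _ else _); apply: eq_ess_inf.
  by apply: filterS fg => x /= ->.
Qed.

Section Lp_normed.
Context (R : realType) (i : interval R) (p : \bar R).
Hypothesis p1 : (1 <= p)%E.
Local Notation mu := (lebesgue_on i).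
Local Notation nrm f := ('N[mu]_p[EFin \o f])%E.

Lemma Lnorm_scale a (f : L0_on i) : Lp_space i p f ->
  (nrm (a *: f : L0_on i) = `|a|%:E * nrm f)%E.
Proof.
move=> finf; have fP : (f : _ -> R) \in Lfun mu p.
  by apply/andP; split; rewrite inE//; exact: measurable_L0.
rewrite -(LnormZ (Lfun_Sub p1 fP)) /=; apply: eq_ae_Lnorm.
- exact: measurable_L0.
- by apply: measurable_funM => //; exact: measurable_L0.
- by apply: filterS (L0_ZE a f) => x ->.
Qed.

Lemma Lnorm_add (f g : L0_on i) : (nrm (f + g : L0_on i)%R <= nrm f + nrm g)%E.
Proof.
apply: le_trans (eminkowski _ (measurable_L0 f) (measurable_L0 g) p1).
rewrite (eq_ae_Lnorm _ _ _ (L0_DE f g))//.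
by apply: measurable_funD; exact: measurable_L0.
Qed.

Lemma Lp_normE (f : L0_on i) : Lp_space i p f -> (Lp_norm i p f)%:E = nrm f.
Proof.
by move=> finf; rewrite /Lp_norm fineK// ge0_fin_numE// Lnorm_ge0.
Qed.

Lemma normed_subspace_Lp : normed_subspace (Lp_space i p) (Lp_norm i p).
Proof.
have Z a (f : L0_on i) : Lp_space i p f -> Lp_space i p (a *: f).
  move=> finf; rewrite /Lp_space /= /finite_norm Lnorm_scale//.
  by rewrite lte_mul_pinfty.
have D (f g : L0_on i) :
    Lp_space i p f -> Lp_space i p g -> Lp_space i p (f + g).
  move=> finf fing; apply: le_lt_trans (Lnorm_add _ _) _.
  by rewrite lte_add_pinfty.
split.
- rewrite /Lp_space /= /finite_norm.
  rewrite (eq_ae_Lnorm (g := cst 0) _ _ _ (L0_0E mu))//.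
  by rewrite Lnorm0 ?ltry// gt_eqF// (lt_le_trans _ p1).
- by move=> a f g finf fing; apply: D => //; exact: Z.
- move=> f finf f0; have := Lp_normE finf; rewrite f0 => /esym.
  move=> /Lnorm_eq0_eq0 => /(_ _ (lt_le_trans lte01 p1)) h.
  have mf : measurable_fun setT (EFin \o (f : L0_on i)).
    by apply/measurable_EFinP; exact: measurable_L0.
  apply: L0P; apply: filterS2 (h mf) (L0_0E mu) => x /(_ I) /= [->] ->.
  by [].
- move=> a f finf; apply: EFin_inj.
  by rewrite EFinM !Lp_normE ?Lnorm_scale//; exact: Z.
- move=> f g finf fing; rewrite -lee_fin EFinD !Lp_normE//; last exact: D.
  exact: Lnorm_add.
Qed.

End Lp_normed.

(** * Derived spaces of sublinear operators *)

(** What it takes for f |-> T |f| to pull the norm of X back to a norm on the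
    space of all f with T |f| in X. *)
Record sublinear_on (R : realType) (i : interval R)
    (T : (R -> \bar R) -> R -> \bar R) : Prop := {
  sublinear_measurable : forall f : L0_on i,
    measurable_fun (setT : set (measurableTypeR R)) (T (abs_fun f)) ;
  sublinear_ge0 : forall f : L0_on i,
    {ae lebesgue_on i, forall x : measurableTypeR R, (0 <= T (abs_fun f) x)%E} ;
  sublinearD : forall f g : L0_on i,
    {ae lebesgue_on i, forall x : measurableTypeR R,
    (T (abs_fun (f + g : L0_on i)%R) x <=
     T (abs_fun f) x + T (abs_fun g) x)%E} ;
  sublinearZ : forall (a : R) (f : L0_on i),
    {ae lebesgue_on i, forall x : measurableTypeR R,
    T (abs_fun (a *: f : L0_on i)) x = (`|a|%:E * T (abs_fun f) x)%E} ;
  sublinear_eq0 : forall f : L0_on i,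
    {ae lebesgue_on i, forall x : measurableTypeR R, T (abs_fun f) x = 0%E} ->
    f = 0 }.

Section derived_space_theory.
Context (R : realType) (i : interval R) (X : set (L0_on i)) (N : L0_on i -> R).
Hypothesis XN : banach_function_space X N.
Variable T : (R -> \bar R) -> R -> \bar R.
Hypothesis slT : sublinear_on i T.
Local Notation mu := (lebesgue_on i).
Local Notation Ta f := (T (abs_fun f)).

Let nX := bfs_normed XN.

Lemma derived_normE (f g : L0_on i) :
  (\forall x \ae mu, (g x)%:E = Ta f x) -> derived_norm T N f = N g.
Proof.
move=> fg; rewrite /derived_norm; congr N.
have := @xgetI _ (0 : L0_on i)
  [set g : L0_on i | \forall x \ae mu, (g x)%:E = Ta f x] g fg.
move=> /= H; apply: L0P; by apply: filterS2 H fg => x <- [].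
Qed.

Lemma bfs_le (f g : L0_on i) : (\forall x \ae mu, 0 <= f x <= g x) -> X g ->
  X f /\ N f <= N g.
Proof.
move=> fg; apply: (bfs_ideal XN); apply: filterS fg => x /andP[f0 fg].
by rewrite !ger0_norm// (le_trans f0).
Qed.

Lemma bfs_of_le_scale (s : R) (f g : L0_on i) : 0 < s ->
  {ae mu, forall x : measurableTypeR R, 0 <= (s *: f : L0_on i) x <= g x} ->
  X g -> X f.
Proof.
move=> s0 /bfs_le fg /fg[Xsf _]; have sN0 : s != 0 by rewrite gt_eqF.
rewrite -[f]scale1r -(mulVf sN0) -scalerA.
exact: (normed_subspace_scale nX).
Qed.

(** A function of X dominating T |f| makes T |f| finite, hence the real-valued
    class that membership in the derived space asks for. *)
Lemma derived_space_le (f g : L0_on i) : X g ->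
  {ae mu, forall x : measurableTypeR R, (Ta f x <= (g x)%:E)%E} ->
  derived_space T X f /\ derived_norm T N f <= N g.
Proof.
move=> Xg fg.
have mfine : measurable_fun setT (fun x : measurableTypeR R => fine (Ta f x)).
  by apply: (measurableT_comp _ (sublinear_measurable slT f)).
pose h : L0_on i := toL0 (lebesgue_on i) mfine.
have hE : \forall x \ae mu, (h x)%:E = Ta f x.
  apply: filterS3 (toL0E mu mfine) fg (sublinear_ge0 slT f) => x -> fgx f0.
  by rewrite fineK// ge0_fin_numE// (le_lt_trans fgx)// ltry.
have [Xh Nh] : X h /\ N h <= N g.
  apply: bfs_le Xg; apply: filterS3 hE fg (sublinear_ge0 slT f) => x <-.
  by rewrite !lee_fin => -> ->.
split; first by exists h.
by rewrite (derived_normE hE).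
Qed.

Lemma derived_space_eq (f : L0_on i) : derived_space T X f ->
  exists g : L0_on i, [/\ X g, \forall x \ae mu, (g x)%:E = Ta f x &
    derived_norm T N f = N g].
Proof. by move=> [g Xg gE]; exists g; split => //; exact: derived_normE. Qed.

(** Each axiom of a norm is obtained by transferring the matching property of
    T |.| to X, where the ideal property turns pointwise inequalities into
    inequalities of norms. *)
Lemma normed_subspace_derived :
  normed_subspace (derived_space T X) (derived_norm T N).
Proof.
have D0 : derived_space T X 0 /\ derived_norm T N 0 <= N 0.
  apply: derived_space_le; first exact: (normed_subspace0 nX).
  have := sublinearZ slT 0 0; rewrite scale0r normr0 => T0.
  by apply: filterS2 T0 (L0_0E mu) => x; rewrite mul0e => -> ->.
have DZ a (f g : L0_on i) : (\forall x \ae mu, (g x)%:E = Ta f x) ->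
    \forall x \ae mu, ((`|a| *: g : L0_on i) x)%:E = Ta (a *: f : L0_on i) x.
  move=> gE.
  apply: filterS3 gE (sublinearZ slT a f) (L0_ZE `|a| g) => x gx -> ->.
  by rewrite EFinM gx.
have DD (f g f' g' : L0_on i) : (\forall x \ae mu, (f' x)%:E = Ta f x) ->
    (\forall x \ae mu, (g' x)%:E = Ta g x) ->
    {ae mu, forall x : measurableTypeR R,
      (Ta (f + g : L0_on i)%R x <= ((f' + g' : L0_on i)%R x)%:E)%E}.
  move=> fE gE; apply: filterS2 (filterI fE gE)
    (filterI (L0_DE f' g') (sublinearD slT f g)).
  by move=> x [fx gx] [-> ]; rewrite EFinD fx gx.
split.
- exact: D0.1.
- move=> a f g /derived_space_eq[f' [Xf fE _]] /derived_space_eq[g' [Xg gE _]].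
  apply: (proj1 (derived_space_le _ (DD _ _ _ _ (DZ a _ _ fE) gE))).
  exact: (normed_subspaceP nX).
- move=> f /derived_space_eq[f' [Xf fE ->]] /(normed_subspace_eq0 nX Xf) f'0.
  apply: (sublinear_eq0 slT); apply: filterS2 fE (L0_0E mu) => x <-.
  by rewrite f'0 => ->.
- move=> a f /derived_space_eq[f' [Xf fE ->]].
  by rewrite (derived_normE (DZ a _ _ fE)) (normed_subspaceZ nX)// normr_id.
- move=> f g /derived_space_eq[f' [Xf fE ->]] /derived_space_eq[g' [Xg gE ->]].
  have := derived_space_le (normed_subspaceD nX Xf Xg) (DD _ _ _ _ fE gE).
  move=> [_ /le_trans]; apply; exact: (normed_subspace_le nX).
Qed.

End derived_space_theory.

(** * Transport between [0, 1] and [a, b] *)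

Section unit_interval_transport.
Context (R : realType) (i : interval R) (a b : R).
Hypotheses (ab : a < b) (abi : [set` `[a, b]] `<=` [set` i]).
Local Notation K := (`[0, 1]%R : interval R).
Local Notation lam := (@lebesgue_measure R).

Let k := b - a.
Let k0 : 0 < k. Proof. by rewrite subr_gt0. Qed.
Let kN0 : k != 0. Proof. by rewrite gt_eqF. Qed.

Let phi (x : measurableTypeR R) : measurableTypeR R :=
  (k^-1 * x + (- (k^-1 * a)))%R.
Let psi (y : measurableTypeR R) : measurableTypeR R := (k * y + a)%R.

Let psiK y : phi (psi y) = y.
Proof. by rewrite /phi /psi; field. Qed.

Let psi_itv y : (psi y \in `[a, b]) = (y \in K).
Proof.
rewrite /psi !in_itv/= lerDr pmulr_rge0//; congr (_ && _).
by rewrite -lerBrDr -/k ger_pMr.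
Qed.

Let phiK x : psi (phi x) = x.
Proof. by rewrite /phi /psi; field. Qed.

Let phi_itv x : (phi x \in K) = (x \in `[a, b]).
Proof. by rewrite -psi_itv phiK. Qed.

Let ae_phi (P : R -> Prop) :
  {ae lebesgue_on K, forall y : measurableTypeR R, P y} ->
  {ae lebesgue_on i, forall x : measurableTypeR R, x \in `[a, b] -> P (phi x)}.
Proof.
have kV0 : 0 < k^-1 by rewrite invr_gt0.
move=> /ae_mrestr/(ae_affine (- (k^-1 * a)) kV0) KP; apply/ae_mrestr.
by apply: filterS KP => x /= Px _ xab; apply: Px; rewrite -/(phi x) phi_itv.
Qed.

Let ae_psi (P : R -> Prop) :
  {ae lebesgue_on i, forall x : measurableTypeR R, P x} ->
  {ae lebesgue_on K, forall y : measurableTypeR R, P (psi y)}.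
Proof.
move=> /ae_mrestr/(ae_affine a k0) iP; apply/ae_mrestr.
apply: filterS iP => y /= Py yK; apply: Py; apply: abi.
by rewrite /= -/(psi y) psi_itv.
Qed.

Let mphi : measurable_fun setT phi. Proof. exact: measurable_affine. Qed.
Let mpsi : measurable_fun setT psi. Proof. exact: measurable_affine. Qed.

Let mfrom (h : L0_on K) : measurable_fun setT
  (fun x : measurableTypeR R =>
    h (phi x) * \1_(`[a, b]%classic : set (measurableTypeR R)) x).
Proof.
apply: measurable_funM; last exact: measurable_indic.
by apply: (measurableT_comp (measurable_L0 h)).
Qed.

(** There is no factor b - a: the renorming only needs a bounded map with a
    bounded left inverse, and this choice serves p = 1 and p = oo alike. *)
Definition from_unit (h : L0_on K) : L0_on i := toL0 (lebesgue_on i) (mfrom h).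

Definition to_unit (f : L0_on i) : L0_on K :=
  toL0 (lebesgue_on K) (measurableT_comp (measurable_L0 f) mpsi).

Let from_unitE (h : L0_on K) : {ae lebesgue_on i, forall x : measurableTypeR R,
  from_unit h x = if x \in `[a, b] then h (phi x) else 0}.
Proof.
apply: filterS (toL0E (lebesgue_on i) (mfrom h)) => x ->.
rewrite indicE mem_setE.
by case: ifPn; rewrite ?mulr1 ?mulr0.
Qed.

Let to_unitE (f : L0_on i) : {ae lebesgue_on K, forall y : measurableTypeR R,
  to_unit f y = f (psi y)}.
Proof. exact: toL0E. Qed.

Lemma from_unit_linear c (z w : L0_on K) :
  from_unit (c *: z + w) = c *: from_unit z + from_unit w.
Proof.
apply: L0P; have H := ae_phi (L0_PE c z w).
apply: filterS2
  (filterI (from_unitE (c *: z + w)) (L0_PE c (from_unit z) (from_unit w)))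
  (filterI (filterI (from_unitE z) (from_unitE w)) H) => x.
move=> [-> ->] [[-> ->] {}H].
by case: ifPn => // xab; rewrite ?H// mulr0 addr0.
Qed.

Lemma to_unit_linear c (f g : L0_on i) :
  to_unit (c *: f + g) = c *: to_unit f + to_unit g.
Proof.
apply: L0P; have H := ae_psi (L0_PE c f g).
by apply: filterS2
  (filterI (to_unitE (c *: f + g)) (L0_PE c (to_unit f) (to_unit g)))
  (filterI (filterI (to_unitE f) (to_unitE g)) H) => x [-> ->] [[-> ->]].
Qed.

Lemma from_unitK : cancel from_unit to_unit.
Proof.
move=> h; apply: L0P; have H := ae_psi (from_unitE h).
have KK : {ae lebesgue_on K, forall y : measurableTypeR R, y \in K}.
  by apply/ae_mrestr/aeW.
apply: filterS3 (to_unitE (from_unit h)) H KK => y -> -> yK.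
by rewrite psi_itv yK psiK.
Qed.

Lemma from_unit_supp (h : L0_on K) :
  {ae lebesgue_on i, forall x : measurableTypeR R,
  x \notin `[a, b] -> from_unit h x = 0}.
Proof. by apply: filterS (from_unitE h) => x -> /negbTE ->. Qed.

Lemma integral_from_unit (h : L0_on K) :
  (\int[lam]_(x in `[a, b]) (abs_fun (from_unit h) x) =
   (b - a)%:E * 'N[lebesgue_on K]_1[EFin \o h])%E.
Proof.
have mh := measurable_L0 h; have mg := measurable_L0 (from_unit h).
rewrite Lnorm1 integral_mrestr//; last by do 2 apply: measurableT_comp => //.
pose F (x : measurableTypeR R) := `|(EFin \o h) x|%E.
have mF : measurable_fun setT F by do 2 apply: measurableT_comp => //.
rewrite -/k -[k in RHS]invrK.
rewrite -(@integral_affine _ k^-1 (- (k^-1 * a)) _ F) ?invr_gt0//; last first.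
  by move=> x; rewrite /F.
have -> : phi @^-1` `[0, 1] = `[a, b]%classic.
  by apply/seteqP; split => x; rewrite /= phi_itv.
apply: ge0_ae_eq_integral => //.
- by apply: measurable_funTS; do 2 apply: measurableT_comp => //.
- by apply: measurable_funTS; exact: (measurableT_comp mF mphi).
- by move=> x _; rewrite /abs_fun lee_fin.
- by move=> x _; rewrite /F.
- have /ae_mrestr H := from_unitE h; apply: filterS H => x + xab.
  by move=> /(_ (abi xab)); rewrite /abs_fun /F /= => ->; rewrite ifT.
Qed.

Lemma integral_to_unit (f : L0_on i) :
  (\int[lam]_(x in `[a, b]) (abs_fun f x) =
   (b - a)%:E * 'N[lebesgue_on K]_1[EFin \o to_unit f])%E.
Proof.
have mf := measurable_L0 f; have mtf := measurable_L0 (to_unit f).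
pose F (x : measurableTypeR R) := abs_fun f x.
have mF : measurable_fun setT F.
  by apply/measurable_EFinP; exact: measurableT_comp.
rewrite Lnorm1 integral_mrestr//; last by do 2 apply: measurableT_comp => //.
transitivity (k%:E * \int[lam]_(y in psi @^-1` `[a, b]) F (psi y))%E.
  rewrite (@integral_affine _ k a _ F)//; last by move=> x; rewrite lee_fin.
  by rewrite muleA -EFinM divff// mul1e.
congr (_ * _)%E.
have -> : psi @^-1` `[a, b] = `[0, 1]%classic.
  by apply/seteqP; split => x; rewrite /= psi_itv.
apply: ge0_ae_eq_integral => //.
- by apply: measurable_funTS; exact: (measurableT_comp mF mpsi).
- by apply: measurable_funTS; do 2 apply: measurableT_comp => //.
- by move=> x _; rewrite /F /abs_fun lee_fin.
- have /ae_mrestr H := to_unitE f; apply: filterS H => x + x01.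
  by move=> /(_ x01); rewrite /F /abs_fun /= => ->.
Qed.

Lemma ess_sup_to_unit (f : L0_on i) (c : \bar R) :
  {ae lebesgue_on i, forall x : measurableTypeR R,
     x \in `[a, b] -> (abs_fun f x <= c)%E} ->
  ('N[lebesgue_on K]_+oo[EFin \o to_unit f] <= c)%E.
Proof.
move=> /ae_psi fc; rewrite unlock /Lnorm ifT; last first.
  by rewrite /= /mrestr setTI lebesgue_measure_itv/= lte01 sube0 lte01.
apply/ess_supP.
have KK : {ae lebesgue_on K, forall y : measurableTypeR R, y \in K}.
  by apply/ae_mrestr/aeW.
apply: filterS3 (to_unitE f) fc KK => y /= -> fc yK.
by apply: fc; rewrite psi_itv.
Qed.

Lemma from_unit_le_ess_sup (h : L0_on K) :
  {ae lebesgue_on i, forall x : measurableTypeR R,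
     (abs_fun (from_unit h) x <= 'N[lebesgue_on K]_+oo[EFin \o h])%E}.
Proof.
have K0 : (0 < lebesgue_on K setT)%E.
  by rewrite /= /mrestr setTI lebesgue_measure_itv/= lte01 sube0 lte01.
have := ess_sup_ge (lebesgue_on K) (abse \o (EFin \o h)).
move=> /ae_phi hh; apply: filterS2 (from_unitE h) hh => x.
rewrite /abs_fun => ->; rewrite unlock /Lnorm K0; case: ifPn => // xab.
  by move=> /(_ isT).
move=> _; rewrite normr0; apply: ess_sup_gee => //.
by apply: aeW => y; rewrite lee_fin.
Qed.

End unit_interval_transport.

Section bracketed.
Context (R : realType) (i : interval R) (X : set (L0_on i)) (N : L0_on i -> R).
Hypothesis XN : banach_function_space X N.
Variable T : (R -> \bar R) -> R -> \bar R.
Hypothesis slT : sublinear_on i T.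
Local Notation mu := (lebesgue_on i).
Local Notation Ta f := (T (abs_fun f)).
Local Notation K := (`[0, 1]%R : interval R).

(** The upper bracket bounds the embedding by N v, and the lower one bounds the
    retraction by 1 / N u. The lower bracket also shows that the retraction has
    values in L^p: T |f| is finite a.e., whereas u is positive on a set of
    positive measure. *)
Lemma renormable_of_bracket (a b : R) (p : \bar R) (u v : L0_on i) :
  a < b -> [set` `[a, b]] `<=` [set` i] -> (1 <= p)%E ->
  X u -> X v -> u <> 0 -> (\forall x \ae mu, 0 <= u x) ->
  (forall f : L0_on i, {ae mu, forall x : measurableTypeR R,
    ((u x)%:E * 'N[lebesgue_on K]_p[EFin \o to_unit a b f] <= Ta f x)%E}) ->
  (forall h : L0_on K, {ae mu, forall x : measurableTypeR R,
    (Ta (from_unit i a b h) x <=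
     (v x)%:E * 'N[lebesgue_on K]_p[EFin \o h])%E}) ->
  renormable_to_contain (derived_space T X) (derived_norm T N)
    (Lp_space K p) (Lp_norm K p).
Proof.
move=> ab abi p1 Xu Xv u0 u_ge0 lo hi.
have nX := bfs_normed XN; have nK := normed_subspace_Lp K p1.
have nu := normed_subspace_gt0 nX Xu u0.
have up (h : L0_on K) : Lp_space K p h ->
    derived_space T X (from_unit i a b h) /\
    derived_norm T N (from_unit i a b h) <= N v * Lp_norm K p h.
  move=> ph; have M0 := normed_subspace_ge0 nK ph.
  rewrite mulrC -{1}(ger0_norm M0) -(normed_subspaceZ nX)//.
  apply: (derived_space_le XN slT); first exact: (normed_subspace_scale nX).
  apply: filterS2 (hi h) (L0_ZE (Lp_norm K p h) v) => x /[swap] ->.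
  by rewrite EFinM Lp_normE// muleC.
have down (f : L0_on i) : derived_space T X f -> Lp_space K p (to_unit a b f).
  move=> [g Xg fg]; rewrite /Lp_space /= /finite_norm ltey.
  apply/negP => /eqP Ny.
  apply: u0; apply: L0P.
  have := lo f; rewrite Ny => lof.
  apply: filterS3 lof fg (filterI u_ge0 (L0_0E mu)) => x /= + fx [ux ->].
  rewrite -fx; move: ux; rewrite le_eqVlt => /predU1P[<-//|ux].
  by rewrite gt0_muley ?lte_fin// leye_eq.
apply: (renormable_of_retract (J := from_unit i a b) (Q := to_unit a b)
  (cJ := N v) (cQ := (N u)^-1)) => //.
- exact: normed_subspace_derived.
- exact: (normed_subspace_ge0 nX).
- by rewrite invr_ge0 ltW.
- by move=> h /up[].
- by move=> c z w _ _; exact: from_unit_linear.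
- by move=> c f g _ _; exact: to_unit_linear.
- by move=> h _; exact: from_unitK.
- by move=> h /up[].
- move=> f Df; have pf := down f Df; have M0 := normed_subspace_ge0 nK pf.
  have [g [Xg fg ->]] := derived_space_eq N Df.
  rewrite ler_pdivlMl// mulrC -{1}(ger0_norm M0) -(normed_subspaceZ nX)//.
  apply: (proj2 (bfs_le XN _ Xg)).
  apply: filterS3
    (filterI (lo f) (L0_ZE (Lp_norm K p (to_unit a b f)) u)) fg u_ge0.
  move=> x [/= + ->] fg ux; rewrite -fg -Lp_normE// -EFinM lee_fin mulrC => ->.
  by rewrite mulr_ge0.
Qed.

End bracketed.

(** * Points of general position in the interval *)

Section half_line_intervals.
Context (R : realType) (i : interval R).
Local Notation lam := (@lebesgue_measure R).

(** The exceptional set consists of the end points. *)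
Lemma ae_interior : i = `[0, 1] \/ i = `[0, +oo[ ->
  {ae lebesgue_on i, forall x : measurableTypeR R,
    0 < x /\ exists2 y, x < y & [set` `[0, y]] `<=` [set` i]}.
Proof.
move=> iE; apply/ae_mrestr.
exists ([set 0] `|` [set 1] : set (measurableTypeR R)).
split.
- by apply: measurableU; exact: measurable_set1.
- apply: countable_lebesgue_measure0.
  apply: finite_set_countable; rewrite finite_setU.
  by split; exact: finite_set1.
move=> x /= H; apply: contrapT => /not_orP[x0 x1]; apply: H.
case: iE => ->; rewrite in_itv/= ?andbT => xi.
  move: xi => /andP[]; rewrite !le_eqVlt.
  move=> /predU1P[/esym//|x0'] /predU1P[//|x1'].
  by split => //; exists 1.
move: xi; rewrite le_eqVlt => /predU1P[/esym//|x0']; split => //.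
exists (x + 1); first by rewrite ltrDl.
by move=> t; rewrite /= !in_itv/= => /andP[->].
Qed.

Lemma ae_meets_itv (G : R -> Prop) (c d : R) : c < d ->
  [set` `[c, d]] `<=` [set` i] ->
  {ae lebesgue_on i, forall x : measurableTypeR R, G x} ->
  exists2 x, x \in `[c, d] & G x.
Proof.
move=> cd cdi /ae_mrestr GA; apply: contrapT => nG.
have : lam.-negligible [set` `[c, d]].
  apply: negligibleS GA => x xcd /= H; apply: nG; exists x => //.
  by apply: H; exact: cdi.
move/measure_negligible => /(_ (measurable_itv _)) /=.
rewrite lebesgue_measure_itv/= => /eqP.
by rewrite lte_fin cd -EFinB eqe subr_eq0 gt_eqF.
Qed.

(** The points x with property G may form an uncountable set, so the null sets
    that they provide cannot be united directly. It is enough to collect, for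
    each rational q lying below some such x, the null set found on [0, q]: every
    interior t lies below one of these q, as G holds almost everywhere. *)
Lemma ae_of_initial_segments (G P : R -> Prop) :
  i = `[0, 1] \/ i = `[0, +oo[ ->
  {ae lebesgue_on i, forall x : measurableTypeR R, G x} ->
  (forall x, G x ->
     {ae lebesgue_on i, forall t : measurableTypeR R, t \in `[0, x] -> P t}) ->
  {ae lebesgue_on i, forall t : measurableTypeR R, P t}.
Proof.
move=> iE GA GP; have ints := ae_interior iE.
pose B (n : nat) (t : measurableTypeR R) : Prop :=
  forall q : rat, unpickle n = Some q -> (exists2 x, G x & ratr q <= x) ->
    0 <= t <= ratr q -> P t.
have BA : {ae lebesgue_on i, forall t, forall n, B n t}.
  apply: ae_foralln => n; rewrite /B.
  case: (unpickle n) => [q|]; last by apply: aeW.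
  have [[x Gx qx]|nx] := pselect (exists2 x, G x & ratr q <= x).
    apply: filterS (GP x Gx) => t Pt _ [<-] _ /andP[t0 tq].
    by apply: Pt; rewrite in_itv/= t0 (le_trans tq).
  by apply: aeW => t _ [<-] /nx.
apply: filterS2 BA ints => t Bt [t0 [y ty yi]].
have [q] := rat_in_itvoo ty; rewrite in_itv/= => /andP[tq qy].
apply: (Bt (pickle q) q); first by rewrite pickleK.
  have [|x] := @ae_meets_itv G _ _ qy _ GA; last first.
    by rewrite in_itv/= => /andP[qx _] Gx; exists x.
  move=> z; rewrite /= in_itv/= => /andP[qz zy]; apply: yi.
  by rewrite /= in_itv/= zy andbT (le_trans (ltW t0))// (le_trans (ltW tq)).
by rewrite (ltW t0) (ltW tq).
Qed.

(** The mirror image of [ae_of_initial_segments], with rationals close to 0. *)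
Lemma ae_of_final_segments (G P : R -> Prop) :
  i = `[0, 1] \/ i = `[0, +oo[ ->
  {ae lebesgue_on i, forall x : measurableTypeR R, G x} ->
  (forall x, G x ->
     {ae lebesgue_on i, forall t : measurableTypeR R, x <= t -> P t}) ->
  {ae lebesgue_on i, forall t : measurableTypeR R, P t}.
Proof.
move=> iE GA GP; have ints := ae_interior iE.
pose B (n : nat) (t : measurableTypeR R) : Prop :=
  forall q : rat, unpickle n = Some q -> (exists2 x, G x & x <= ratr q) ->
    ratr q <= t -> P t.
have BA : {ae lebesgue_on i, forall t, forall n, B n t}.
  apply: ae_foralln => n; rewrite /B.
  case: (unpickle n) => [q|]; last by apply: aeW.
  have [[x Gx qx]|nx] := pselect (exists2 x, G x & x <= ratr q).
    apply: filterS (GP x Gx) => t Pt _ [<-] _ tq.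
    by apply: Pt; rewrite (le_trans qx).
  by apply: aeW => t _ [<-] /nx.
apply: filterS2 BA ints => t Bt [t0 [y ty yi]].
have [q] := rat_in_itvoo t0; rewrite in_itv/= => /andP[q0 qt].
apply: (Bt (pickle q) q); [by rewrite pickleK| |exact: ltW].
have [|x] := @ae_meets_itv G _ _ q0 _ GA; last first.
  by rewrite in_itv/= => /andP[_ qx] Gx; exists x.
move=> z; rewrite /= in_itv/= => /andP[z0 zq]; apply: yi.
by rewrite /= in_itv/= z0 (le_trans zq)// (le_trans (ltW qt))// ltW.
Qed.

End half_line_intervals.

Lemma nondecreasing_emeasurable (R : realType) (f : R -> \bar R) :
  {homo f : x y / x <= y >-> (x <= y)%E} ->
  measurable_fun (setT : set (measurableTypeR R)) f.
Proof.
move=> fle.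
apply: (measurability (@ErealGenCInfty.G R)) => [|/= _ [_] [r] -> <-].
  exact: ErealGenCInfty.measurableE.
rewrite setTI; apply: is_interval_measurable => s t/=.
rewrite !in_itv/= !andbT => fs ft u /andP[su ut].
by rewrite in_itv/= andbT (le_trans fs)// fle.
Qed.

Lemma nonincreasing_emeasurable (R : realType) (f : R -> \bar R) :
  {homo f : x y / x <= y >-> (y <= x)%E} ->
  measurable_fun (setT : set (measurableTypeR R)) f.
Proof.
move=> fge.
apply: (measurability (@ErealGenCInfty.G R)) => [|/= _ [_] [r] -> <-].
  exact: ErealGenCInfty.measurableE.
rewrite setTI; apply: is_interval_measurable => s t/=.
rewrite !in_itv/= !andbT => fs ft u /andP[su ut].
by rewrite in_itv/= andbT (le_trans ft)// fge.
Qed.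

Lemma measurable_inv (R : realType) :
  measurable_fun (setT : set (measurableTypeR R))
    (fun x : measurableTypeR R => x^-1 : measurableTypeR R).
Proof.
(* The real power t `^ (-1) is the inverse of t for t >= 0 only, hence the
   square. *)
have -> : (fun x : R => x^-1) = (fun x => (x ^+ 2) `^ (-1) * x).
  apply/funext => x; rewrite powR_inv1 ?sqr_ge0//.
  have [->|x0] := eqVneq x 0; first by rewrite invr0 mulr0.
  by field.
apply: measurable_funM => //.
by apply: (@measurableT_comp _ _ _ _ _ _ (@powR R ^~ (-1))) => //;
  exact: measurable_funX.
Qed.

Lemma gt0_ge_fin (R : realType) (y : \bar R) : (0 < y)%E ->
  exists2 s : R, 0 < s & (s%:E <= y)%E.
Proof.
case: y => [r| |//]; first by rewrite lte_fin => r0; exists r.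
by exists 1 => //; rewrite leey.
Qed.

(** * Integral operators over a monotone family of sets *)

(** The common shape of the Cesaro operator (w x = 1/x, k = 1, S x = [0, x]) and
    of the Copson operator (w = 1, k t = 1/t, S x = I `&` [x, oo)). *)
Definition windowed_integral (R : realType) (w k : R -> R) (S : R -> set R)
    (F : R -> \bar R) (x : R) : \bar R :=
  ((w x)%:E * \int[lebesgue_measure]_(t in S x) (F t * (k t)%:E))%E.

(** Monotonicity of S makes the integral over S x measurable in x. The last
    field expresses that the sets S x, for x outside a null set, exhaust the
    interval; it makes the operator definite. *)
Record window (R : realType) (i : interval R) (w k : R -> R) (S : R -> set R) :
    Prop := {
  window_measurable_factor :
    measurable_fun (setT : set (measurableTypeR R))
      (w : measurableTypeR R -> R) ;
  window_measurable_kernel :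
    measurable_fun (setT : set (measurableTypeR R))
      (k : measurableTypeR R -> R) ;
  window_measurable_set : forall x, measurable (S x : set (measurableTypeR R)) ;
  window_kernel_ge0 : forall x t, S x t -> 0 <= k t ;
  window_monotone : (forall x y, x <= y -> S x `<=` S y) \/
    (forall x y, x <= y -> S y `<=` S x) ;
  window_factor_gt0 :
    {ae lebesgue_on i, forall x : measurableTypeR R, 0 < w x} ;
  window_kernel_gt0 :
    {ae lebesgue_on i, forall t : measurableTypeR R, 0 < k t} ;
  window_sub : {ae lebesgue_on i, forall x : measurableTypeR R,
    S x `<=` [set` i]} ;
  window_exhaust : forall G P : R -> Prop,
    {ae lebesgue_on i, forall x : measurableTypeR R, G x} ->
    (forall x, G x ->
       {ae lebesgue_on i, forall t : measurableTypeR R, S x t -> P t}) ->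
    {ae lebesgue_on i, forall t : measurableTypeR R, P t} }.

Section windowed_integral_theory.
Context (R : realType) (i : interval R) (w k : R -> R) (S : R -> set R).
Hypothesis win : window i w k S.
Local Notation lam := (@lebesgue_measure R).
Local Notation T := (windowed_integral w k S).
Local Notation I f x := (\int[lam]_(t in S x) (abs_fun f t * (k t)%:E))%E.

Let mS := window_measurable_set win.

Let mint (f : L0_on i) : measurable_fun setT
  (fun t : measurableTypeR R => abs_fun f t * (k t)%:E)%E.
Proof.
apply: emeasurable_funM; apply/measurable_EFinP.
  by apply: measurableT_comp => //; exact: measurable_L0.
exact: (window_measurable_kernel win).
Qed.

Let mintS (f : L0_on i) x : measurable_fun (S x : set (measurableTypeR R))
  (fun t : measurableTypeR R => abs_fun f t * (k t)%:E)%E.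
Proof. by apply: measurable_funTS; exact: mint. Qed.

Let int_ge0 (f : L0_on i) x t : S x t -> (0 <= abs_fun f t * (k t)%:E)%E.
Proof.
by move=> /(window_kernel_ge0 win) kt; rewrite mule_ge0// lee_fin.
Qed.

Let I_ge0 (f : L0_on i) x : (0 <= I f x)%E.
Proof. by apply: integral_ge0 => t; exact: int_ge0. Qed.

Lemma sublinear_windowed_integral : sublinear_on i T.
Proof.
split.
- move=> f; apply: emeasurable_funM.
    by apply/measurable_EFinP; exact: (window_measurable_factor win).
  case: (window_monotone win) => SS.
    apply: nondecreasing_emeasurable => x y xy.
    by apply: ge0_subset_integral => //; [exact: int_ge0|exact: SS].
  apply: nonincreasing_emeasurable => x y xy.
  by apply: ge0_subset_integral => //; [exact: int_ge0|exact: SS].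
- move=> f; apply: filterS (window_factor_gt0 win) => x w0.
  by rewrite mule_ge0// lee_fin ltW.
- move=> f g.
  apply: filterS2 (window_factor_gt0 win) (window_sub win) => x w0 Sx.
  rewrite /windowed_integral -ge0_muleDr// lee_pmul2l//.
  rewrite -ge0_integralD//; [|exact: int_ge0|exact: int_ge0].
  apply: ae_ge0_le_integral => //.
  + exact: int_ge0.
  + by move=> t St; rewrite adde_ge0// (@int_ge0 _ x).
  + by apply: emeasurable_funD.
  + have /ae_mrestr H := L0_DE f g; apply: filterS H => t + St.
    move=> /(_ (Sx _ St)); rewrite /abs_fun => ->.
    rewrite -!EFinM -EFinD lee_fin -mulrDl ler_wpM2r ?ler_normD//.
    exact: (window_kernel_ge0 win St).
- move=> a f; apply: filterS (window_sub win) => x Sx.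
  rewrite /windowed_integral muleCA; congr (_ * _)%E.
  rewrite -ge0_integralZl_EFin//; last exact: int_ge0.
  apply: ge0_ae_eq_integral => //.
  + exact: measurable_funeM.
  + exact: int_ge0.
  + by move=> t St; rewrite mule_ge0// (@int_ge0 _ x).
  + have /ae_mrestr H := L0_ZE a f; apply: filterS H => t + St.
    move=> /(_ (Sx _ St)); rewrite /abs_fun => ->.
    by rewrite -!EFinM normrM mulrA.
- move=> f T0; apply: L0P.
  pose G x := [/\ T (abs_fun f) x = 0%E, 0 < w x & S x `<=` [set` i]].
  apply: (@window_exhaust _ _ _ _ _ win G).
    by apply: filterS3 T0 (window_factor_gt0 win) (window_sub win).
  move=> x [Tx w0 Sx]; apply/ae_mrestr.
  have : (\int[lam]_(t in S x) `|abs_fun f t * (k t)%:E| = 0)%E.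
    under eq_integral => t /[!inE] St do rewrite gee0_abs ?(@int_ge0 _ x)//.
    by move/eqP : Tx; rewrite mule_eq0 eqe gt_eqF//= => /eqP.
  move=> /(ae_eq_integral_abs lam (@mS x) (@mintS f x)) H.
  have /ae_mrestr H0 := L0_0E (lebesgue_on i).
  have /ae_mrestr Hk := window_kernel_gt0 win.
  apply: filterS3 H H0 Hk => t ft zt kt it St.
  have := ft St; rewrite zt// /abs_fun -EFinM => -[] /eqP.
  by rewrite mulf_eq0 (gt_eqF (kt it)) orbF normr_eq0 => /eqP.
Qed.

(** Here x0 is a point where the integral for |F| is positive. The windows of
    the points of E0 contain S x0, so the integral stays bounded below on E0 and
    w 1_E0 is in X; the windows of the points outside E0 miss [a, b], and those
    of the points of E1 contain it. As k lies between k0 and k1 on [a, b], the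
    brackets are multiples of w 1_E1 and w 1_E0. The interval [c, d] inside E1
    only serves to make the first of them nonzero. *)
Lemma windowed_integral_renormable (X : set (L0_on i)) (N : L0_on i -> R)
    (XN : banach_function_space X N) (F : L0_on i) (x0 a b k0 k1 : R)
    (E0 E1 : set (measurableTypeR R)) :
  derived_space T X F -> (0 < I F x0)%E ->
  a < b -> [set` `[a, b]] `<=` [set` i] ->
  0 < k0 -> (forall t, t \in `[a, b] -> k0 <= k t <= k1) ->
  measurable E0 -> measurable E1 -> E1 `<=` E0 ->
  (forall x, E0 x -> S x0 `<=` S x) ->
  (forall x, E1 x -> [set` `[a, b]] `<=` S x) ->
  (forall x t, S x t -> t \in `[a, b] -> E0 x) ->
  (exists c d,
     [/\ c < d, [set` `[c, d]] `<=` [set` i] & [set` `[c, d]] `<=` E1]) ->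
  renormable_to_contain (derived_space T X) (derived_norm T N)
    (Lp_space `[0, 1] 1%E) (Lp_norm `[0, 1] 1%E).
Proof.
move=> DF IF ab abi k0_gt0 kab mE0 mE1 E10 SE0 SE1 E0S [c [d [cd cdi cdE1]]].
have nX := bfs_normed XN.
have mw := window_measurable_factor win.
have mw0 : measurable_fun setT (fun x : measurableTypeR R => w x * \1_E0 x).
  by apply: measurable_funM => //; exact: measurable_indic.
have mw1 : measurable_fun setT (fun x : measurableTypeR R => w x * \1_E1 x).
  by apply: measurable_funM => //; exact: measurable_indic.
pose v0 := toL0 (lebesgue_on i) mw0; pose u0 := toL0 (lebesgue_on i) mw1.
have v0E := toL0E (lebesgue_on i) mw0; have u0E := toL0E (lebesgue_on i) mw1.
have wp := window_factor_gt0 win.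
have [s s0 sI] := gt0_ge_fin IF.
have Xv0 : X v0.
  have [g [Xg gE _]] := derived_space_eq N DF.
  apply: (bfs_of_le_scale XN s0 _ Xg).
  apply: filterS3 (filterI v0E (L0_ZE s v0)) gE wp => x [vx ->] gx w0.
  rewrite [v0 x]vx indicE; have [/set_mem xE|_] := boolP (x \in E0); last first.
    by rewrite !mulr0 lexx/= -lee_fin gx mule_ge0// lee_fin ltW.
  rewrite mulr1 (mulr_ge0 (ltW s0) (ltW w0))/= -lee_fin gx mulrC EFinM.
  rewrite lee_pmul2l//.
  apply: (le_trans sI); apply: ge0_subset_integral => //; first exact: int_ge0.
  exact: SE0.
have Xu0 : X u0.
  suff /(bfs_le XN) /(_ Xv0) [] : {ae lebesgue_on i,
    forall x : measurableTypeR R, 0 <= u0 x <= v0 x} by [].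
  apply: filterS3 v0E u0E wp => x vx ux w0.
  rewrite [v0 x]vx [u0 x]ux !indicE (mulr_ge0 (ltW w0) (ler0n _ _))/=.
  rewrite (ler_wpM2l (ltW w0))// ler_nat.
  have [/set_mem/E10 xE|//] := boolP (x \in E1).
  by rewrite (mem_set xE).
have ba0 : 0 < b - a by rewrite subr_gt0.
pose u := (k0 * (b - a)) *: u0; pose v := (k1 * (b - a)) *: v0.
have uE : {ae lebesgue_on i, forall x : measurableTypeR R,
    (u : L0_on i) x = k0 * (b - a) * (w x * \1_E1 x)}.
  by apply: filterS2 u0E (L0_ZE (k0 * (b - a)) u0) => x ux ->; rewrite [u0 x]ux.
have vE : {ae lebesgue_on i, forall x : measurableTypeR R,
    (v : L0_on i) x = k1 * (b - a) * (w x * \1_E0 x)}.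
  by apply: filterS2 v0E (L0_ZE (k1 * (b - a)) v0) => x vx ->; rewrite [v0 x]vx.
apply: (renormable_of_bracket XN sublinear_windowed_integral
  (u := u) (v := v) ab abi).
- by [].
- exact: (normed_subspace_scale nX).
- exact: (normed_subspace_scale nX).
- move=> u_0.
  have H : {ae lebesgue_on i, forall x : measurableTypeR R,
      0 < w x /\ \1_E1 x = 0 :> R}.
    apply: filterS3 uE wp (L0_0E (lebesgue_on i)) => x ux w0 zx; split => //.
    move: ux; rewrite u_0 zx => /esym/eqP.
    by rewrite !mulf_eq0 (gt_eqF k0_gt0) (gt_eqF ba0) (gt_eqF w0) => /eqP.
  have [x xcd [_ /eqP]] := ae_meets_itv cd cdi H.
  by rewrite indicE mem_set ?oner_eq0//; exact: cdE1.
- apply: filterS2 uE wp => x -> w0; rewrite indicE.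
  by rewrite !mulr_ge0 ?ler0n// ltW.
- move=> f; apply: filterS2 uE wp => x -> w0.
  have mf := measurable_L0 f.
  have maf : measurable_fun setT (abs_fun f : measurableTypeR R -> _).
    by apply/measurable_EFinP; exact: measurableT_comp.
  rewrite indicE; have [/set_mem/SE1 abS|_] := boolP (x \in E1); last first.
    by rewrite !mulr0 mul0e mule_ge0// lee_fin ltW.
  rewrite mulr1 mulrC EFinM -muleA lee_pmul2l// EFinM -muleA -integral_to_unit//.
  apply: (@le_trans _ _ (\int[lam]_(t in `[a, b]) (abs_fun f t * (k t)%:E))%E).
    rewrite -ge0_integralZl_EFin//; last 3 first.
    + by move=> t _; rewrite lee_fin.
    + exact: measurable_funTS.
    + exact: ltW.
    + apply: ge0_le_integral => //.
      * by move=> t _; rewrite mule_ge0// lee_fin// ltW.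
      * by apply: measurable_funTS; exact: measurable_funeM.
      * by apply: measurable_funTS; exact: mint.
      * move=> t /kab /andP[kt _]; rewrite muleC lee_wpmul2l ?lee_fin//.
  by apply: ge0_subset_integral => //; exact: int_ge0.
- move=> h; set f := from_unit i a b h.
  have mf := measurable_L0 f.
  have maf : measurable_fun setT (abs_fun f : measurableTypeR R -> _).
    by apply/measurable_EFinP; exact: measurableT_comp.
  apply: filterS3 vE wp (window_sub win) => x -> w0 Sx.
  have -> : (k1 * (b - a) * (w x * \1_E0 x))%R =
            (w x * (\1_E0 x * (k1 * (b - a))))%R by ring.
  rewrite EFinM -muleA lee_pmul2l// EFinM EFinM -!muleA.
  rewrite -(integral_from_unit ab abi).
  have k1_ge0 : 0 <= k1.
    have /kab/andP[k0a ak1] : a \in `[a, b] by rewrite in_itv/= lexx ltW.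
    exact: le_trans (ltW k0_gt0) (le_trans k0a ak1).
  rewrite -ge0_integralZl_EFin//; last 2 first.
    by move=> t _; rewrite lee_fin.
    exact: measurable_funTS.
  rewrite -ge0_integralZl_EFin//; last 2 first.
    by move=> t _; rewrite mule_ge0// lee_fin.
    by apply: measurable_funTS; exact: measurable_funeM.
  (* The two domains S x and [a, b] are unrelated, so both integrands are cut
     off and compared on the whole line. *)
  rewrite [leLHS]integral_mkcond [leRHS]integral_mkcond.
  have /ae_mrestr fs := @from_unit_supp R i a b h.
  apply: ae_ge0_le_integral => //.
  - by move=> t _; rewrite patchE; case: ifPn => // /set_mem; exact: int_ge0.
  - by apply/(measurable_restrictT _ (@mS x)); exact: mintS.
  - move=> t _; rewrite patchE; case: ifPn => // _.
    by rewrite !mule_ge0// lee_fin.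
  - apply/(measurable_restrictT _ (measurable_itv _)); apply: measurable_funTS.
    by do 2 apply: measurable_funeM.
  apply: filterS fs => t ft _; rewrite !patchE.
  case: ifPn => [/set_mem St|_]; last first.
    by case: ifPn => // _; rewrite !mule_ge0// lee_fin.
  case: ifPn => [/set_mem tab|].
    rewrite indicE mem_set ?mul1e; last exact: (E0S _ t).
    by rewrite muleC lee_wpmul2r// lee_fin; have /andP[] := kab _ tab.
  move=> /negP tab; rewrite /abs_fun ft ?normr0 ?mul0e//; first exact: Sx.
  by apply/negP => tab'; apply: tab; exact: mem_set.
Qed.

End windowed_integral_theory.

(** * The Cesaro, Copson and Tandori spaces *)

Lemma derived_space_nontrivial (R : realType) (i : interval R)
    (X : set (L0_on i)) (N : L0_on i -> R) (T : (R -> \bar R) -> R -> \bar R) :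
  banach_function_space X N -> sublinear_on i T ->
  derived_space T X <> [set 0] -> exists2 F, derived_space T X F & F <> 0.
Proof.
move=> XN slT D0; apply: contrapT => nF; apply: D0.
apply/seteqP; split=> [F DF|_ ->].
  by apply: contrapT => F0; apply: nF; exists F.
exact: (normed_subspace0 (normed_subspace_derived XN slT)).
Qed.

Lemma sublinear_gt0 (R : realType) (i : interval R)
    (T : (R -> \bar R) -> R -> \bar R) (F : L0_on i) (G : R -> Prop) :
  sublinear_on i T -> F <> 0 ->
  {ae lebesgue_on i, forall x : measurableTypeR R, G x} ->
  exists2 x, G x & (0 < T (abs_fun F) x)%E.
Proof.
move=> slT F0 GA; apply: contrapT => nx; apply: F0; apply: (sublinear_eq0 slT).
apply: filterS2 (sublinear_ge0 slT F) GA => x + Gx; rewrite le_eqVlt.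
by move=> /predU1P[//|Tx]; exfalso; apply: nx; exists x.
Qed.

Lemma windowed_integral_gt0 (R : realType) (w k : R -> R) (S : R -> set R)
    (F : R -> \bar R) (x : R) : 0 < w x ->
  (0 < windowed_integral w k S F x)%E ->
  (0 < \int[lebesgue_measure]_(t in S x) (F t * (k t)%:E))%E.
Proof. by move=> w0; rewrite /windowed_integral pmule_rgt0. Qed.

Section operators.
Context (R : realType) (i : interval R).
Hypothesis iE : i = `[0, 1] \/ i = `[0, +oo[.

Let itv_ge0 (x : R) : x \in i -> 0 <= x.
Proof. by case: iE => ->; rewrite in_itv/= => /andP[]. Qed.

Lemma cesaro_windowed : cesaro_op =
  windowed_integral (fun x : R => x^-1) (cst 1) (fun x => [set` `[0, x]]).
Proof.
apply/funext => F; apply/funext => x; rewrite /cesaro_op /windowed_integral.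
by congr (_ * _)%E; apply: eq_integral => t _; rewrite mule1.
Qed.

Lemma copson_windowed : copson_op i =
  windowed_integral (cst 1) (fun t : R => t^-1)
    (fun x => [set` i] `&` [set` `[x, +oo[]).
Proof.
apply/funext => F; apply/funext => x.
by rewrite /copson_op /windowed_integral mul1e.
Qed.

Lemma cesaro_window :
  window i (fun x : R => x^-1) (cst 1) (fun x => [set` `[0, x]]).
Proof.
have ints := ae_interior iE; split=> //.
- exact: measurable_inv.
- left=> x y xy t; rewrite /= !in_itv/= => /andP[-> tx].
  exact: le_trans xy.
- by apply: filterS ints => x [x0 _]; rewrite invr_gt0.
- by apply: aeW.
- apply: filterS ints => x [_ [y xy yi]] t; rewrite /= in_itv/= => /andP[t0 tx].
  by apply: yi; rewrite /= in_itv/= t0 (le_trans tx)// ltW.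
- by move=> G P GA GP; exact: (ae_of_initial_segments iE GA).
Qed.

Lemma copson_window :
  window i (cst 1) (fun t : R => t^-1)
    (fun x => [set` i] `&` [set` `[x, +oo[]).
Proof.
have ints := ae_interior iE; split=> //.
- exact: measurable_inv.
- by move=> x; exact: measurableI.
- by move=> x t [/itv_ge0 t0 _]; rewrite invr_ge0.
- right=> x y xy t [ti yt]; split=> //; move: yt; rewrite /= !in_itv/= !andbT.
  exact: le_trans.
- by apply: aeW.
- by apply: filterS ints => x [x0 _]; rewrite invr_gt0.
- by apply: aeW => x; exact: subIsetl.
- move=> G P GA GP; apply: (ae_of_final_segments iE GA) => x Gx.
  have /ae_mrestr H := GP x Gx; apply/ae_mrestr.
  apply: filterS H => t + ti xt; apply => //; split => //.
  by rewrite /= in_itv/= xt.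
Qed.

(** The window [0, x] contains [0, x0] from x = x0 on, and contains [x0, b] from
    x = b on; b is chosen so as to leave the room [b, y] inside I. *)
Lemma cesaro_renormable (X : set (L0_on i)) (N : L0_on i -> R) :
  banach_function_space X N -> derived_space cesaro_op X <> [set 0] ->
  renormable_to_contain (derived_space cesaro_op X) (derived_norm cesaro_op N)
    (Lp_space `[0, 1] 1%E) (Lp_norm `[0, 1] 1%E).
Proof.
rewrite cesaro_windowed => XN.
have sl := sublinear_windowed_integral cesaro_window.
move=> /(derived_space_nontrivial XN sl)[F DF F0].
have [x0 [x0_gt0 [y x0y yi]] TF] := sublinear_gt0 sl F0 (ae_interior iE).
pose b := (x0 + y) / 2.
have x0b : x0 < b by rewrite midf_lt.
have bY : b < y by rewrite midf_lt.
apply: (windowed_integral_renormable cesaro_window XN (a := x0) (b := b)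
  (k0 := 1) (k1 := 1)
  (E0 := [set` `[x0, +oo[]) (E1 := [set` `[b, +oo[]) DF) => //.
- by apply: (windowed_integral_gt0 _ TF); rewrite invr_gt0.
- move=> t; rewrite /= in_itv/= => /andP[xt tb]; apply: yi.
  by rewrite /= in_itv/= (le_trans (ltW x0_gt0))//= (le_trans tb)// ltW.
- by move=> t _; rewrite lexx.
- move=> t; rewrite /= !in_itv/= !andbT; exact: le_trans (ltW x0b).
- move=> x; rewrite /= in_itv/= andbT => x0x t.
  rewrite /= !in_itv/= => /andP[-> tx].
  exact: le_trans x0x.
- move=> x; rewrite /= in_itv/= andbT => bx t.
  rewrite /= !in_itv/= => /andP[xt tb].
  by rewrite (le_trans (ltW x0_gt0))//= (le_trans tb).
- move=> x t; rewrite /= !in_itv/= andbT => /andP[_ tx] /andP[x0t _].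
  exact: le_trans tx.
- exists b, y; split => //.
  + move=> t; rewrite /= in_itv/= => /andP[bt ty]; apply: yi.
    rewrite /= in_itv/= ty andbT (le_trans (ltW x0_gt0))//.
    by rewrite (le_trans (ltW x0b)).
  + by move=> t; rewrite /= !in_itv/= => /andP[->].
Qed.

(** The window I `&` [x, oo) contains the one of b up to x = b, and contains
    [a, b] up to x = a. The point b/2 is an arbitrary choice for a in (0, b);
    a > 0 keeps 1/t bounded on [a, b]. *)
Lemma copson_renormable (X : set (L0_on i)) (N : L0_on i -> R) :
  banach_function_space X N -> derived_space (copson_op i) X <> [set 0] ->
  renormable_to_contain (derived_space (copson_op i) X)
    (derived_norm (copson_op i) N)
    (Lp_space `[0, 1] 1%E) (Lp_norm `[0, 1] 1%E).
Proof.
rewrite copson_windowed => XN.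
have sl := sublinear_windowed_integral copson_window.
move=> /(derived_space_nontrivial XN sl)[F DF F0].
have [b [b0 [y yb yi]] TF] := sublinear_gt0 sl F0 (ae_interior iE).
pose a := b / 2.
have a0 : 0 < a by rewrite divr_gt0.
have ab : a < b by rewrite ltr_pdivrMr// ltr_pMr// ltr1n.
apply: (windowed_integral_renormable copson_window XN
  (x0 := b) (a := a) (b := b) (k0 := b^-1) (k1 := a^-1)
  (E0 := [set` `]-oo, b]]) (E1 := [set` `]-oo, a]]) DF) => //.
- exact: (windowed_integral_gt0 _ TF).
- move=> t; rewrite /= in_itv/= => /andP[xt tb]; apply: yi.
  by rewrite /= in_itv/= (le_trans (ltW a0))//= (le_trans tb)// ltW.
- by rewrite invr_gt0.
- move=> t; rewrite in_itv/= => /andP[a_t tb]; have t0 := lt_le_trans a0 a_t.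
  by rewrite !lef_pV2// ?posrE// tb a_t.
- by move=> t; rewrite /= !in_itv/= => ta; rewrite (le_trans ta)// ltW.
- move=> x; rewrite /= in_itv/= => xb t [ti bt]; split=> //; move: bt.
  by rewrite /= !in_itv/= !andbT; exact: le_trans.
- move=> x; rewrite /= in_itv/= => xa t; rewrite /= in_itv/= => /andP[a_t tb].
  split; last by rewrite /= in_itv/= (le_trans xa).
  by apply: yi; rewrite /= in_itv/= (le_trans (ltW a0))//= (le_trans tb)// ltW.
- move=> x t [_]; rewrite /= !in_itv/= andbT => xt /andP[_ tb].
  exact: le_trans tb.
- exists 0, a; split => //.
  + move=> t; rewrite /= in_itv/= => /andP[t0 ta]; apply: yi.
    by rewrite /= in_itv/= t0 (le_trans ta)// (le_trans (ltW ab))// ltW.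
  + by move=> t; rewrite /= !in_itv/= => /andP[_].
Qed.

Lemma tandori_leP (F : R -> \bar R) (x : R) (c : \bar R) :
  (tandori_majorant i F x <= c)%E <->
  {ae lebesgue_on i, forall t : measurableTypeR R, x <= t -> (F t <= c)%E}.
Proof.
rewrite /tandori_majorant; split.
  move=> /ess_supP/ae_mrestr; apply: filterS => t Ft xt; apply: Ft.
  by rewrite /= in_itv/= xt.
move=> Fc; apply/ess_supP/ae_mrestr; apply: filterS Fc => t Ft.
by rewrite /= in_itv/= andbT.
Qed.

Lemma tandori_ge (F : R -> \bar R) (x : R) :
  {ae lebesgue_on i, forall t : measurableTypeR R,
    x <= t -> (F t <= tandori_majorant i F x)%E}.
Proof. exact/tandori_leP. Qed.

(** The essential supremum behaves like a supremum of nonnegative numbers only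
    with respect to a nonzero measure; with respect to the zero measure it
    is -oo. *)
Lemma tandori_measure_gt0 (x y : R) : x < y -> 0 <= x ->
  [set` `[0, y]] `<=` [set` i] ->
  (0 < mrestr (lebesgue_on i) (measurable_itv `[x, +oo[) setT)%E.
Proof.
move=> xy x0 yi; rewrite /= /mrestr /= setTI.
apply: (@lt_le_trans _ _
  (lebesgue_measure (`[x, y]%classic : set (measurableTypeR R)))).
  by rewrite lebesgue_measure_itv/= lte_fin xy -EFinB lte_fin subr_gt0.
apply: le_measure; rewrite ?inE//; first exact: measurableI.
move=> t; rewrite /= in_itv/= => /andP[xt ty]; split.
  by rewrite /= in_itv/= xt.
by apply: yi; rewrite /= in_itv/= ty (le_trans x0).
Qed.

Lemma sublinear_tandori : sublinear_on i (tandori_majorant i).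
Proof.
have ints := ae_interior iE; split.
- move=> f; apply: nonincreasing_emeasurable => x y xy.
  apply/tandori_leP.
  by apply: filterS (tandori_ge (abs_fun f) x) => t H /(le_trans xy).
- move=> f; apply: filterS ints => x [x0 [y xy yi]].
  apply: ess_sup_gee; first exact: (tandori_measure_gt0 xy (ltW x0) yi).
  by apply: aeW => t; rewrite lee_fin.
- move=> f g; apply: aeW => x; apply/tandori_leP.
  apply: filterS3 (L0_DE f g) (tandori_ge (abs_fun f) x)
    (tandori_ge (abs_fun g) x) => t fg ft gt xt.
  apply: le_trans (leeD (ft xt) (gt xt)).
  by rewrite /abs_fun fg -EFinD lee_fin ler_normD.
- move=> c f; apply: filterS ints => x [x0 [y xy yi]].
  rewrite /tandori_majorant -ess_supZl//; last first.
    exact: (tandori_measure_gt0 xy (ltW x0) yi).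
  apply: eq_ess_sup; apply/ae_mrestr; apply: filterS (L0_ZE c f) => t cf _.
  by rewrite /abs_fun cf normrM EFinM.
- move=> f T0; apply: L0P; apply: (ae_of_final_segments iE T0) => x Tx.
  have /tandori_leP H : (tandori_majorant i (abs_fun f) x <= 0)%E by rewrite Tx.
  apply: filterS2 (L0_0E (lebesgue_on i)) H => t -> ft xt.
  by apply/eqP; have := ft xt; rewrite lee_fin normr_le0.
Qed.

(** With a < b as for the Copson operator: the majorant of a function that
    vanishes outside [a, b] vanishes beyond b, and up to a the majorant of any f
    is at least the essential supremum of |f| over [a, b]. *)
Lemma tandori_renormable (X : set (L0_on i)) (N : L0_on i -> R) :
  banach_function_space X N ->
  derived_space (tandori_majorant i) X <> [set 0] ->
  renormable_to_contain (derived_space (tandori_majorant i) X)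
    (derived_norm (tandori_majorant i) N)
    (Lp_space `[0, 1] +oo%E) (Lp_norm `[0, 1] +oo%E).
Proof.
move=> XN; have sl := sublinear_tandori.
move=> /(derived_space_nontrivial XN sl)[F DF F0].
have [b [b0 [y yb yi]] TF] := sublinear_gt0 sl F0 (ae_interior iE).
pose a := b / 2.
have a0 : 0 < a by rewrite divr_gt0.
have ab : a < b by rewrite ltr_pdivrMr// ltr_pMr// ltr1n.
have mI (c : R) : measurable_fun setT
    (\1_(`]-oo, c]%classic : set (measurableTypeR R)) : measurableTypeR R -> R).
  exact: measurable_indic.
pose u := toL0 (lebesgue_on i) (mI a); pose v := toL0 (lebesgue_on i) (mI b).
have IE (c : R) : {ae lebesgue_on i, forall x : measurableTypeR R,
    toL0 (lebesgue_on i) (mI c) x = if x <= c then 1 else 0}.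
  apply: filterS (toL0E (lebesgue_on i) (mI c)) => x ->.
  by rewrite indicE mem_setE in_itv/=; case: ifPn.
have [s s0 sI] := gt0_ge_fin TF.
have Xv : X v.
  have [g [Xg gE _]] := derived_space_eq N DF.
  apply: (bfs_of_le_scale XN s0 _ Xg).
  apply: filterS3 (filterI (IE b) (L0_ZE s v)) gE (sublinear_ge0 sl F).
  move=> x [vx ->] gx Tx; rewrite [v x]vx; case: ifPn => xb; last first.
    by rewrite mulr0 lexx/= -lee_fin gx.
  rewrite mulr1 (ltW s0)/= -lee_fin gx; apply: (le_trans sI).
  apply/tandori_leP.
  by apply: filterS (tandori_ge (abs_fun F) x) => t H /(le_trans xb).
have Xu : X u.
  suff /(bfs_le XN) /(_ Xv) [] : {ae lebesgue_on i,
    forall x : measurableTypeR R, 0 <= u x <= v x} by [].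
  apply: filterS2 (IE a) (IE b) => x ux vx; rewrite [u x]ux [v x]vx.
  have [xa|_] := leP x a; first by rewrite (le_trans xa (ltW ab)) ler01 lexx.
  by rewrite lexx; case: (x <= b); [exact: ler01|exact: lexx].
have abi : [set` `[a, b]] `<=` [set` i].
  move=> t; rewrite /= in_itv/= => /andP[xt tb]; apply: yi.
  by rewrite /= in_itv/= (le_trans (ltW a0))//= (le_trans tb)// ltW.
have bracket := @renormable_of_bracket R i X N XN _ sl a b +oo%E u v ab abi.
apply: bracket => //.
- by rewrite leey.
- move=> u_0.
  have H : {ae lebesgue_on i, forall x : measurableTypeR R, ~~ (x <= a)}.
    apply: filterS2 (IE a) (L0_0E (lebesgue_on i)) => x ux zx.
    apply/negP => xa; move: ux; rewrite -/u u_0 zx xa => /eqP.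
    by rewrite eq_sym oner_eq0.
  have [|x] := ae_meets_itv a0 _ H; last first.
    by rewrite in_itv/= => /andP[_ ->].
  move=> t; rewrite /= in_itv/= => /andP[t0 ta]; apply: yi.
  by rewrite /= in_itv/= t0 (le_trans ta)// (le_trans (ltW ab))// ltW.
- by apply: filterS (IE a) => x ux; rewrite [u x]ux; case: ifPn.
- move=> f; apply: filterS2 (IE a) (sublinear_ge0 sl f) => x ux Tx.
  rewrite [u x]ux; case: ifPn => xa; last by rewrite mul0e.
  rewrite mul1e; apply: ess_sup_to_unit => //.
  apply: filterS (tandori_ge (abs_fun f) x) => t H.
  by rewrite in_itv/= => /andP[a_t _]; exact: H (le_trans xa a_t).
- move=> h; apply: filterS (IE b) => x vx; rewrite [v x]vx.
  apply/tandori_leP; case: ifPn => xb.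
    rewrite mul1e. apply: filterS (from_unit_le_ess_sup i ab h) => t + _.
    exact.
  rewrite mul0e; apply: filterS (@from_unit_supp R i a b h) => t ht xt.
  rewrite /abs_fun ht ?normr0// in_itv/= negb_and -!ltNge orbC.
  by rewrite (lt_le_trans _ xt)// ltNge.
Qed.

End operators.



Theorem theorem4p4 (R : realType) :
  (forall X Z : completeNormedModType R,
     contains_complemented_copy X Z ->
     renormable_to_contain [set: X] (fun x : X => `|x|)
                           [set: Z] (fun z : Z => `|z|))
  /\
  (forall (i : interval R) (X : set (L0_on i)) (N : L0_on i -> R),
     i = `[0, 1] \/ i = `[0, +oo[ ->
     banach_function_space X N ->
     (forall T : (R -> \bar R) -> R -> \bar R,
        T = cesaro_op \/ T = copson_op i ->
        derived_space T X <> [set 0] ->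
        renormable_to_contain
          (derived_space T X) (derived_norm T N)
          (Lp_space `[0, 1] 1%E) (Lp_norm `[0, 1] 1%E))
     /\
     (derived_space (tandori_majorant i) X <> [set 0] ->
        renormable_to_contain
          (derived_space (tandori_majorant i) X) (derived_norm (tandori_majorant i) N)
          (Lp_space `[0, 1] +oo%E) (Lp_norm `[0, 1] +oo%E))).
Proof.
split=> [X Z|i X N iE XN]; first exact: renormable_of_complemented_copy.
split=> [T [->|->]|].
- exact: cesaro_renormable.
- exact: copson_renormable.
- exact: tandori_renormable.
Qed.
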